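(* Let $D$ be an integral domain and let $*$ be a star operation of finite type on $D$. If $D$ is a $*$-VIFD, then $D$ is an integrally closed weakly Matlis domain.
   Context: Let $D$ be an integral domain with quotient field $K$. An overring of $D$ is a subring of $K$ containing $D$. $F(D)$ (resp. $f(D)$) is the set of nonzero fractional (resp. nonzero finitely generated fractional) ideals of $D$; for $A\in F(D)$, $A^{-1}=\{x\in K\mid xA\subseteq D\}$. A star operation on $D$ is a map $*:F(D)\to F(D)$, $A\mapsto A_*$, such that for all $A,B\in F(D)$ and nonzero $c\in K$: $A\subseteq A_*=(A_* )_*$; $A\subseteq B$ implies $A_*\subseteq B_*$; $(cA)_*=cA_*$; $D_*=D$. It is of finite type if $A_*=\bigcup_{C\in f(D),\,C\subseteq A}C_*$ for all $A\in F(D)$. The $t$-operation is the star operation $A_t=\bigcup\{J_v\mid J\in f(D),\ J\subseteq A\}$, where $J_v=(J^{-1})^{-1}$. A $t$-ideal is an $I\in F(D)$ with $I\subseteq D$ and $I_t=I$; a maximal $t$-ideal is a $t$-ideal maximal among the proper $t$-ideals. An ideal $I$ of $D$ is a valuation ideal if there is a valuation overring $V$ of $D$ with $IV\cap D=I$ ($D$ itself is allowed). $D$ is a $*$-VIFD ($*$-valuation ideal factorization domain) if each nonzero principal ideal $I$ of $D$ can be written as $I=(\prod_{i=1}^n I_i)_*$ with $n\in\mathbb{N}$ and valuation ideals $I_i$ of $D$. $D$ is weakly Matlis if each nonzero nonunit of $D$ is contained in only finitely many maximal $t$-ideals and every nonzero prime $t$-ideal of $D$ is contained in a unique maximal $t$-ideal.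 *)

(* Defs.v *)
From HB Require Import structures.
From mathcomp Require Import all_boot all_order all_algebra.
From mathcomp Require Import boolp classical_sets cardinality.

Set Implicit Arguments.
Unset Strict Implicit.
Unset Printing Implicit Defensive.

Import GRing.Theory.
Local Open Scope classical_set_scope.
Local Open Scope ring_scope.

(* The quotient field of D is {fraction D}.  Fractional ideals, integral     *)
(* ideals and overrings of D are all subsets of {fraction D}; D itself is    *)
(* identified with its image carrierD.                                       *)

Section FractionalIdeals.
Variable D : idomainType.
Local Notation K := {fraction D}.
Implicit Types (A B C I J M P V : set K) (x y c : K).

Definition carrierD : set K := range (@tofrac D).

Definition submodule A : Prop :=
  [/\ A 0, (forall x y, A x -> A y -> A (x + y))
    & forall (d : D) x, A x -> A (tofrac d * x)].

Definition scaleI c A : set K := [set c * x | x in A].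

(* The set F(D): nonzero fractional ideals. *)
Definition fracI A : Prop :=
  [/\ submodule A, (exists2 x, A x & x != 0)
    & exists2 d : D, d != 0 & scaleI (tofrac d) A `<=` carrierD].

Definition spanD (s : seq K) : set K :=
  [set x | exists d : 'I_(size s) -> D, x = \sum_i tofrac (d i) * s`_i].

(* The set f(D): nonzero finitely generated fractional ideals. *)
Definition fgfracI A : Prop := fracI A /\ exists s : seq K, A = spanD s.

Definition invI A : set K := [set x | scaleI x A `<=` carrierD].

(* For submodules A, B this is the product AB; for an ideal I of D and an    *)
(* overring V it is the extension IV.                                        *)
Definition mulI A B : set K :=
  [set x | exists n (a b : 'I_n -> K),
     [/\ forall i, A (a i), forall i, B (b i) & x = \sum_i a i * b i]].

Definition v_op A : set K := invI (invI A).

Definition t_op A : set K :=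
  \bigcup_(J in [set J | fgfracI J /\ J `<=` A]) v_op J.

(* A star operation F(D) -> F(D) is a total map on subsets of K of which     *)
(* only the values on F(D) are constrained.                                  *)
Record star_operation (star : set K -> set K) : Prop := StarOperation {
  star_fracI : forall A, fracI A -> fracI (star A);
  star_ext : forall A, fracI A -> A `<=` star A;
  star_idem : forall A, fracI A -> star (star A) = star A;
  star_mono : forall A B, fracI A -> fracI B -> A `<=` B -> star A `<=` star B;
  star_scale : forall c A, c != 0 -> fracI A ->
    star (scaleI c A) = scaleI c (star A);
  star_unit : star carrierD = carrierD
}.

Definition star_finite_type (star : set K -> set K) : Prop :=
  forall A, fracI A ->
    star A = \bigcup_(C in [set C | fgfracI C /\ C `<=` A]) star C.

Definition is_ideal I : Prop := submodule I /\ I `<=` carrierD.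

Definition prime_idealD P : Prop :=
  [/\ is_ideal P, P <> carrierD
    & forall a b : D, P (tofrac (a * b)) -> P (tofrac a) \/ P (tofrac b)].

Definition t_ideal I : Prop := [/\ fracI I, I `<=` carrierD & t_op I = I].

Definition maximal_t_ideal M : Prop :=
  [/\ t_ideal M, M <> carrierD
    & forall J, t_ideal J -> J <> carrierD -> M `<=` J -> J = M].

Definition overring V : Prop :=
  subring_closed [in V] /\ carrierD `<=` V.

(* V = K is allowed: fields count as valuation domains. *)
Definition valuation_overring V : Prop :=
  overring V /\ forall x, x != 0 -> V x \/ V x^-1.

Definition valuation_ideal I : Prop :=
  is_ideal I /\
  exists2 V, valuation_overring V & mulI I V `&` carrierD = I.

(* The condition fracI on the product says that star is applied inside its   *)
(* domain F(D), i.e. that the product is nonzero.                            *)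
Definition star_VIFD (star : set K -> set K) : Prop :=
  forall a : D, a != 0 ->
  exists n (I : 'I_n -> set K),
    let prodI := \big[mulI/carrierD]_(i < n) I i in
    [/\ (0 < n)%N, forall i, valuation_ideal (I i), fracI prodI
      & scaleI (tofrac a) carrierD = star prodI].

End FractionalIdeals.

Arguments star_VIFD : clear implicits.

Definition integrally_closed (D : idomainType) : Prop :=
  forall x : {fraction D}, integralOver (@tofrac D) x -> carrierD x.

Definition weakly_Matlis (D : idomainType) : Prop :=
  (forall a : D, a != 0 -> a \isn't a GRing.unit ->
     finite_set [set M | maximal_t_ideal M /\ M (tofrac a)]) /\
  (forall P : set {fraction D}, prime_idealD P -> t_ideal P ->
     exists! M, maximal_t_ideal M /\ P `<=` M).

(* Main.v *)
Require Import Defs.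
From mathcomp Require Import all_boot all_order all_algebra generic_quotient.
From mathcomp Require Import boolp classical_sets cardinality.

(** Let a be nonzero and a D = (I_1 ... I_n)_* with valuation ideals I_k.
    Each I_k is star-invertible, and two consequences of this suffice: the
    elements of K that multiply I_k into itself are those of D
    (factor_multiplier_trivial) and, star being of finite type, I_k is
    generated up to divisorial closure by finitely many of its elements
    (factor_v_finite).

    Integral closure.  An integral element x lies in every valuation overring
    and some nonzero a satisfies a x in D, so x I_1 ... I_n is contained in D.
    For z in I_2 ... I_n the ideal x z I_1 is contained both in D and in
    I_1 V_1, hence in I_1, so x z is in D.  Thus the factor I_1 can be
    stripped, and after n steps x itself is in D (prodI_multiplier).

    Weak Matlis property.  Let I = I V meet D be one of the factors.  Every
    t-ideal T containing I is closed under passing to elements of D of larger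
    V-value (t_ideal_valuation_closed), that is, T is itself contracted from V.
    Hence the t-ideals containing I form a chain (t_ideals_over_chain) and,
    unless none of them is proper, exactly one of them is a maximal t-ideal.
    A prime t-ideal that contains a, in particular a maximal t-ideal, contains
    one of the finitely many factors of a D.  Therefore a lies in at most n
    maximal t-ideals, and a prime t-ideal lies in exactly one. *)

Set Implicit Arguments.
Unset Strict Implicit.
Unset Printing Implicit Defensive.

Import GRing.Theory.
Local Open Scope classical_set_scope.
Local Open Scope ring_scope.

Section TIdeals.
Variable D : idomainType.
Local Notation K := {fraction D}.
Local Notation carrierD := (@carrierD D).
Implicit Types (A B C I J M P T V : set K) (x y z u : K) (s : seq K).

(** * Submodules of the quotient field *)

Lemma carrierD1 : carrierD 1.
Proof. by exists 1 => //; rewrite tofrac1. Qed.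

Lemma carrierDM x y : carrierD x -> carrierD y -> carrierD (x * y).
Proof. by move=> [a _ <-] [b _ <-]; exists (a * b) => //; rewrite tofracM. Qed.

Lemma carrierD_submodule : submodule carrierD.
Proof.
split; first by exists 0 => //; rewrite tofrac0.
- by move=> _ _ [a _ <-] [b _ <-]; exists (a + b) => //; rewrite tofracD.
- by move=> a x Dx; apply: carrierDM => //; exists a.
Qed.

Lemma submoduleM A x y : submodule A -> carrierD x -> A y -> A (x * y).
Proof. by move=> [_ _ AZ] [d _ <-]; apply: AZ. Qed.

Lemma submodule_sum A n (f : 'I_n -> K) :
  submodule A -> (forall i, A (f i)) -> A (\sum_i f i).
Proof. by move=> [A0 AD _] Af; elim/big_ind: _. Qed.

Lemma submodule_scale c A : submodule A -> submodule (scaleI c A).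
Proof.
move=> [A0 AD AZ]; split; first by exists 0; rewrite ?mulr0.
- move=> _ _ [x Ax <-] [y Ay <-].
  by exists (x + y); [apply: AD | rewrite mulrDr].
- move=> d _ [x Ax <-].
  by exists (tofrac d * x); [apply: AZ | rewrite mulrCA].
Qed.

Lemma frac_denominator x : exists2 d : D, d != 0 & carrierD (tofrac d * x).
Proof.
elim/quotW: x => r; exists (frac r).2; first exact: denom_ratioP.
exists (frac r).1 => //; apply/esym; unlock tofrac.
rewrite /GRing.mul /= !piE; apply/eqmodP.
rewrite /= FracField.equivfE /FracField.mulf.
by rewrite !numden_Ratio ?oner_eq0 ?mul1r ?mulr1 ?denom_ratioP.
Qed.

Lemma sub_fracI A B :
  fracI A -> submodule B -> (exists2 x, B x & x != 0) -> B `<=` A -> fracI B.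
Proof.
move=> [_ _ [d d0 dA]] sB nzB BA; split=> //; exists d => // _ [x Bx <-].
by apply: dA; exists x => //; apply: BA.
Qed.

Lemma integral_fracI A :
  submodule A -> (exists2 x, A x & x != 0) -> A `<=` carrierD -> fracI A.
Proof.
move=> sA nzA AD; split=> //; exists 1; first exact: oner_neq0.
by move=> _ [x Ax <-]; rewrite tofrac1 mul1r; apply: AD.
Qed.

Lemma spanD_submodule s : submodule (spanD s).
Proof.
split; first by exists (fun=> 0); rewrite big1 // => i _; rewrite tofrac0 mul0r.
- move=> _ _ [d ->] [e ->]; exists (fun i => d i + e i).
  by rewrite -big_split; apply: eq_bigr => i _ /=; rewrite tofracD mulrDl.
- move=> c _ [d ->]; exists (fun i => c * d i).
  by rewrite mulr_sumr; apply: eq_bigr => i _ /=; rewrite tofracM mulrA.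
Qed.

Lemma mem_spanD s y : y \in s -> spanD s y.
Proof.
move=> sy; have ilt : (index y s < size s)%N by rewrite index_mem.
exists (fun j => if j == Ordinal ilt then 1 else 0).
rewrite (bigD1 (Ordinal ilt)) //= eqxx tofrac1 mul1r nth_index //.
by rewrite big1 ?addr0 // => j /negPf->; rewrite tofrac0 mul0r.
Qed.

Lemma spanD_sub s A :
  submodule A -> (forall y, y \in s -> A y) -> spanD s `<=` A.
Proof.
move=> sA As _ [d ->]; apply: submodule_sum => // i.
by apply: submoduleM => //; [exists (d i) | apply/As/mem_nth].
Qed.

Lemma spanD_fgfracI s A : fracI A -> (forall y, y \in s -> A y) ->
  (exists2 y, y \in s & y != 0) -> fgfracI (spanD s).
Proof.
move=> fA As [y sy y0]; split; last by exists s.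
apply: (sub_fracI fA); first exact: spanD_submodule.
- by exists y => //; apply: mem_spanD.
- by case: fA => sA _ _; apply: spanD_sub.
Qed.

(** * Ideals of finite type for the t-operation *)

(** The divisorial closure of the span of s (see v_op_spanD), phrased
    elementwise so that s may be empty or consist of zeros. *)
Definition vclosure s : set K :=
  [set x | forall u, (forall y, y \in s -> carrierD (u * y)) ->
           carrierD (u * x)].

Lemma vclosure_submodule s : submodule (vclosure s).
Proof.
have [D0 DD _] := carrierD_submodule.
split; first by move=> u _; rewrite mulr0.
- by move=> x y sx sy u us; rewrite mulrDr; apply: DD; [apply: sx | apply: sy].
- move=> d x sx u us; rewrite mulrCA.
  by apply: carrierDM; [exists d | apply: sx].
Qed.

Lemma vclosure_trans s s' x :
  (forall y, y \in s' -> vclosure s y) -> vclosure s' x -> vclosure s x.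
Proof. by move=> ss' s'x u us; apply: s'x => y /ss'; apply. Qed.

Lemma vclosureS s s' x : {subset s <= s'} -> vclosure s x -> vclosure s' x.
Proof. by move=> ss' sx u us; apply: sx => y /ss'; apply: us. Qed.

Lemma mem_vclosure s y : y \in s -> vclosure s y.
Proof. by move=> sy u; apply. Qed.

Lemma v_op_spanD s : v_op (spanD s) = vclosure s.
Proof.
apply/seteqP; split=> [x vx u us | x sx _ [u uJ <-]].
  rewrite mulrC; apply: vx; exists u => // _ [y Jy <-].
  case: Jy => d ->; rewrite mulr_sumr.
  apply: submodule_sum => [|i]; first exact: carrierD_submodule.
  rewrite mulrCA; apply: carrierDM; first by exists (d i).
  exact/us/mem_nth.
rewrite mulrC; apply: sx => y sy; apply: uJ; exists y => //.
exact: mem_spanD.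
Qed.

(** Adding a nonzero element of T to s turns the span of s into a fractional
    ideal without leaving T, so the fractional ideals in the definition of
    the t-operation can be replaced by arbitrary finite lists. *)
Lemma t_idealP T : t_ideal T <->
  [/\ submodule T, exists2 x, T x & x != 0, T `<=` carrierD
    & forall s, (forall y, y \in s -> T y) -> vclosure s `<=` T].
Proof.
split=> [[fT TD tT] | [sT nzT TD clT]].
  have [sT nzT _] := fT; split=> // s sub_sT x sx.
  have [z Tz z0] := nzT; rewrite -tT.
  have sub_zsT y : y \in z :: s -> T y.
    by rewrite inE => /orP[/eqP-> | /sub_sT].
  exists (spanD (z :: s)); last first.
    by rewrite v_op_spanD; apply: vclosureS sx => y sy; rewrite inE sy orbT.
  split; last exact: spanD_sub.
  by apply: (spanD_fgfracI fT) => //; exists z => //; rewrite mem_head.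
have fT := integral_fracI sT nzT TD; split=> //; apply/seteqP; split.
  move=> x [_ [[_ [s ->]] sJT]]; rewrite v_op_spanD; apply: clT => y sy.
  exact/sJT/mem_spanD.
move=> x Tx; have [z Tz z0] := nzT.
have sub_zxT y : y \in [:: z; x] -> T y.
  by rewrite !inE => /orP[] /eqP->.
exists (spanD [:: z; x]); last first.
  by rewrite v_op_spanD; apply: mem_vclosure; rewrite !inE eqxx orbT.
split; last exact: spanD_sub.
by apply: (spanD_fgfracI fT) => //; exists z => //; rewrite mem_head.
Qed.

Definition tclosure A : set K :=
  [set x | exists2 s : seq K, forall y, y \in s -> A y & vclosure s x].

Lemma sub_tclosure A : A `<=` tclosure A.
Proof.
move=> x Ax; exists [:: x]; last by apply: mem_vclosure; rewrite mem_head.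
by move=> y; rewrite inE => /eqP->.
Qed.

(** This is what makes tclosure idempotent: finitely many elements of the
    closure are already in the divisorial closure of one finite list. *)
Lemma tclosure_list A s : (forall y, y \in s -> tclosure A y) ->
  exists2 s', forall y, y \in s' -> A y & forall y, y \in s -> vclosure s' y.
Proof.
elim: s => [_|x s IHs sA]; first by exists [::].
have [|s1 s1A s1P] := IHs; first by move=> y sy; apply: sA; rewrite inE sy orbT.
have [s2 s2A s2P] := sA x (mem_head x s).
exists (s2 ++ s1) => [y | y].
  by rewrite mem_cat => /orP[/s2A | /s1A].
rewrite inE => /orP[/eqP-> | sy].
  by apply: vclosureS s2P => z zs; rewrite mem_cat zs.
by apply: vclosureS (s1P y sy) => z zs; rewrite mem_cat zs orbT.
Qed.

(** The value at 1 of the defining property of vclosure keeps the closure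
    inside D. *)
Lemma tclosure_t_ideal A :
  (exists2 x, A x & x != 0) -> A `<=` carrierD -> t_ideal (tclosure A).
Proof.
move=> [z Az z0] AD; apply/t_idealP.
have clA s : (forall y, y \in s -> tclosure A y) -> vclosure s `<=` tclosure A.
  move=> /tclosure_list[s' s'A ss'] x sx.
  by exists s' => //; apply: vclosure_trans sx.
split=> //; last 2 first.
- by exists z => //; apply: sub_tclosure.
- by move=> x [s sA /(_ 1)]; rewrite mul1r; apply=> y /sA/AD; rewrite mul1r.
split.
- by exists [::] => // u _; rewrite mulr0; case: carrierD_submodule.
- move=> x y Ax Ay; have xyA w : w \in [:: x; y] -> tclosure A w.
    by rewrite !inE => /orP[] /eqP->.
  apply: clA xyA _ _; have [_ vD _] := vclosure_submodule [:: x; y].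
  by apply: vD; apply: mem_vclosure; rewrite !inE eqxx ?orbT.
- move=> d x [s sA sx]; exists s => //.
  by have [_ _] := vclosure_submodule s; apply.
Qed.

(** If M contains x y but not x, the t-closure of M and x contains 1, and
    multiplying by y the finitely many elements that witness it brings them
    all into M. *)
Lemma maximal_t_ideal_prime M x y : maximal_t_ideal M ->
  carrierD x -> carrierD y -> M (x * y) -> M x \/ M y.
Proof.
move=> [tM MnD maxM] Dx Dy Mxy; case: (pselect (M x)) => Mx; [by left | right].
have /t_idealP[sM [z Mz z0] MD clM] := tM.
pose A := M `|` [set x].
have tA : t_ideal (tclosure A).
  apply: tclosure_t_ideal; first by exists z => //; left.
  by move=> w [/MD // | ->].
have AD : tclosure A = carrierD.
  apply: contrapT => /(maxM _ tA) AM; apply: Mx; rewrite -AM.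
    by apply: sub_tclosure; right.
  by move=> w Mw; apply: sub_tclosure; left.
have [s sA s1] : tclosure A 1 by rewrite AD; exact: carrierD1.
apply: (clM [seq y * w | w <- s]).
  move=> _ /mapP[w /sA[Mw | ->] ->]; first exact: submoduleM.
  by rewrite mulrC.
move=> u us; rewrite -[u * y]mulr1; apply: s1 => w sw.
by rewrite -mulrA; apply/us/map_f.
Qed.

(** * Products of ideals *)

Lemma mulI_mem A B x y : A x -> B y -> mulI A B (x * y).
Proof.
by move=> Ax By; exists 1%N, (fun=> x), (fun=> y); rewrite big_ord1.
Qed.

Lemma mulI_sub A B C : submodule C ->
  (forall x y, A x -> B y -> C (x * y)) -> mulI A B `<=` C.
Proof.
move=> sC ABC _ [n [a [b [Aa Bb ->]]]].
by apply: submodule_sum => // i; apply: ABC.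
Qed.

Lemma mulI_submodule A B : submodule B -> submodule (mulI A B).
Proof.
move=> [B0 BD BZ]; split.
- by exists 0%N, (fun=> 0), (fun=> 0); split; [case | case | rewrite big_ord0].
- move=> _ _ [m [a [b [Aa Bb ->]]]] [n [c [d [Ac Bd ->]]]].
  exists (m + n)%N.
  exists (fun i => match split i with inl j => a j | inr j => c j end).
  exists (fun i => match split i with inl j => b j | inr j => d j end).
  split; try by move=> i; case: (split i).
  rewrite big_split_ord /=; congr (_ + _); apply: eq_bigr => i _.
    by rewrite -[lshift n i]/(unsplit (inl i)) unsplitK.
  by rewrite -[rshift m i]/(unsplit (inr i)) unsplitK.
- move=> d _ [n [a [b [Aa Bb ->]]]]; exists n, a, (fun i => tofrac d * b i).
  split=> //; first by move=> i; apply: BZ.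
  by rewrite mulr_sumr; apply: eq_bigr => i _; rewrite mulrCA.
Qed.

Definition prodI n (I : 'I_n -> set K) : set K :=
  \big[@mulI D/carrierD]_(i < n) I i.

Lemma prodI0 (I : 'I_0 -> set K) : prodI I = carrierD.
Proof. exact: big_ord0. Qed.

Lemma prodIS n (I : 'I_n.+1 -> set K) :
  prodI I = mulI (I ord0) (prodI (fun i => I (lift ord0 i))).
Proof. exact: big_ord_recl. Qed.

Lemma prodI_submodule n (I : 'I_n -> set K) : submodule (prodI I).
Proof.
elim: n I => [|n IHn] I; first by rewrite prodI0; exact: carrierD_submodule.
by rewrite prodIS; apply: mulI_submodule.
Qed.

Lemma prodI_integral n (I : 'I_n -> set K) :
  (forall i, I i `<=` carrierD) -> prodI I `<=` carrierD.
Proof.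
elim: n I => [|n IHn] I ID; first by rewrite prodI0.
rewrite prodIS; apply: mulI_sub; first exact: carrierD_submodule.
by move=> x y /ID Dx /IHn Dy; apply: carrierDM Dx (Dy _) => i; apply: ID.
Qed.

Lemma prodI_stable n (I : 'I_n -> set K) k u :
  (forall z, I k z -> I k (u * z)) -> forall w, prodI I w -> prodI I (u * w).
Proof.
elim: n I k => [|n IHn] I k; first by case: k.
have [j ->|->] := unliftP ord0 k => uI w.
  rewrite prodIS => -[m [a [b [Ia Bb ->]]]].
  exists m, a, (fun i => u * b i); split=> // [i | ]; first exact: (IHn _ j).
  by rewrite mulr_sumr; apply: eq_bigr => i _; rewrite mulrCA.
rewrite prodIS => -[m [a [b [Ia Bb ->]]]].
exists m, (fun i => u * a i), b; split=> // [i | ]; first exact: uI.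
by rewrite mulr_sumr; apply: eq_bigr => i _; rewrite mulrA.
Qed.

(** An element w of the product is a finite sum of products of elements of
    the factors; s lists those that come from the k-th one. *)
Lemma prodI_factor_list n (I : 'I_n -> set K) k w : prodI I w ->
  exists2 s : seq K, forall y, y \in s -> I k y &
    forall u z, (forall y, y \in s -> carrierD (u * y)) -> I k z ->
      prodI I (u * z * w).
Proof.
elim: n I k w => [|n IHn] I k w; first by case: k.
rewrite prodIS => -[m [a [b [Ia Bb ->]]]].
have [j ->|->] := unliftP ord0 k; last first.
  exists [seq a i | i <- enum 'I_m] => [_ /mapP[i _ ->] // | u z us Iz].
  exists m, (fun=> z), (fun i => u * a i * b i); split=> // [i|].
    apply: submoduleM; [exact: prodI_submodule | apply: us | by []].
    by rewrite map_f // mem_enum.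
  rewrite mulr_sumr; apply: eq_bigr => i _.
  by rewrite -mulrA mulrCA !mulrA.
have {IHn}/choice[t tP] i :
    exists s : seq K, (forall y, y \in s -> I (lift ord0 j) y) /\
    forall u z, (forall y, y \in s -> carrierD (u * y)) -> I (lift ord0 j) z ->
      prodI (fun i => I (lift ord0 i)) (u * z * b i).
  by have [s sI sP] := IHn (fun i => I (lift ord0 i)) j _ (Bb i); exists s.
exists (flatten [seq t i | i <- enum 'I_m]) => [y | u z us Iz].
  by case/flatten_mapP => i _; have [+ _] := tP i; apply.
exists m, a, (fun i => u * z * b i); split=> // [i|].
  have [_ tiP] := tP i; apply: tiP => // y ty; apply: us.
  by apply/flatten_mapP; exists i => //; rewrite mem_enum.
by rewrite mulr_sumr; apply: eq_bigr => i _; rewrite mulrCA.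
Qed.

Lemma prime_contains_factor n (I : 'I_n -> set K) P :
  (forall i, I i `<=` carrierD) -> P `<=` carrierD -> P <> carrierD ->
  submodule P ->
  (forall x y, carrierD x -> carrierD y -> P (x * y) -> P x \/ P y) ->
  prodI I `<=` P -> exists i, I i `<=` P.
Proof.
move=> ID PD PnD sP primeP; elim: n I ID => [|n IHn] I ID.
  by rewrite prodI0 => DP; case: PnD; apply/seteqP.
rewrite prodIS => prodP.
case: (pselect (I ord0 `<=` P)) => [I0P | /existsNP[x]]; first by exists ord0.
case/not_implyP=> I0x nPx.
have [||i IiP] := IHn (fun i => I (lift ord0 i)); first by move=> i; apply: ID.
  move=> y By; case: (primeP x y) => //; first exact: ID I0x.
    by apply: prodI_integral By => i; apply: ID.
  by apply: prodP; apply: mulI_mem.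
by exists (lift ord0 i).
Qed.

(** * Invertible valuation ideals *)

(** Together with v_finite below, this is all that the rest of the proof
    retains of the star-invertibility of I. *)
Definition multiplier_trivial I : Prop :=
  forall u, (forall z, I z -> I (u * z)) -> carrierD u.

Definition v_finite I : Prop :=
  exists2 s : seq K, forall y, y \in s -> I y & I `<=` vclosure s.

Section StarFactors.
Variable star : set K -> set K.
Hypotheses (star_op : star_operation star) (star_ft : star_finite_type star).
Variables (a : D) (n : nat) (I : 'I_n -> set K).
Hypotheses (a0 : a != 0) (frac_prod : fracI (prodI I)).
Hypothesis (aE : scaleI (tofrac a) carrierD = star (prodI I)).

Let fa0 : tofrac a != 0 :> K. Proof. by rewrite tofrac_eq0. Qed.

Lemma factor_integral_cancel u : scaleI (tofrac a) carrierD (u * tofrac a) ->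
  carrierD u.
Proof. by move=> [d Dd]; rewrite mulrC => /(mulIf fa0) <-. Qed.

(** As u C is contained in the product, u a lies in (u C)_*, hence in the star
    closure of the product, which is a D. *)
Lemma star_multiplier C u : fracI C -> star C (tofrac a) ->
  (forall w, C w -> prodI I (u * w)) -> carrierD u.
Proof.
move=> fC Ca uC.
have [-> | u0] := eqVneq u 0; first by case: (carrierD_submodule).
apply: factor_integral_cancel; rewrite aE.
have uCsub : scaleI u C `<=` prodI I by move=> _ [w Cw <-]; apply: uC.
have fuC : fracI (scaleI u C).
  have [sC [w Cw w0] _] := fC; apply: sub_fracI uCsub => //.
    exact: submodule_scale.
  by exists (u * w); [exists w | rewrite mulf_neq0].
apply: (star_mono star_op fuC frac_prod uCsub).
by rewrite star_scale //; exists (tofrac a).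
Qed.

Let prod_a : star (prodI I) (tofrac a).
Proof. by rewrite -aE; exists 1; rewrite ?mulr1 //; exact: carrierD1. Qed.

Lemma factor_multiplier_trivial k : multiplier_trivial (I k).
Proof.
move=> u uI; apply: (star_multiplier frac_prod) => //.
exact: prodI_stable uI.
Qed.

(** Since star has finite type, a lies in the star closure of finitely many
    elements of the product; collecting the elements of I k that occur in
    them gives the list. *)
Lemma factor_v_finite k : v_finite (I k).
Proof.
have := prod_a; rewrite star_ft // => -[C [[fC [t CE]] CI] Ca].
have {}CI i : prodI I (t`_i).
  have [lti | gei] := ltnP i (size t); last first.
    by rewrite nth_default //; case: (prodI_submodule I).
  by apply: CI; rewrite CE; apply/mem_spanD/mem_nth.
have /choice[r rP] i : exists s : seq K, (forall y, y \in s -> I k y) /\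
    forall u z, (forall y, y \in s -> carrierD (u * y)) -> I k z ->
      prodI I (u * z * t`_i).
  by have [s] := prodI_factor_list k (CI i); exists s.
exists (flatten [seq r i | i <- iota 0 (size t)]) => [y | z Iz u us].
  by case/flatten_mapP => i _; have [+ _] := rP i; apply.
apply: (star_multiplier fC Ca) => w; rewrite CE => -[d ->].
rewrite mulr_sumr; apply: submodule_sum => [|i]; first exact: prodI_submodule.
rewrite mulrCA; apply: submoduleM; [exact: prodI_submodule | by exists (d i) |].
have [_ riP] := rP i; apply: riP => // y ry; apply: us.
by apply/flatten_mapP; exists (nat_of_ord i); rewrite ?mem_iota /=.
Qed.

Lemma prodI_sub_star T : submodule T -> T (tofrac a) -> prodI I `<=` T.
Proof.
move=> sT Ta w /(star_ext star_op frac_prod); rewrite -aE => -[d Dd <-].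
by rewrite mulrC; apply: submoduleM.
Qed.

End StarFactors.

Lemma overring_mul V x y : overring V -> V x -> V y -> V (x * y).
Proof.
by move=> [[_ _ VM] _] Vx Vy; have := VM x y; rewrite !inE; apply.
Qed.

Lemma overring_submodule V : overring V -> submodule V.
Proof.
move=> oV; have [[V1 VB _] DV] := oV.
have V0 : V 0 by have := VB 1 1 V1 V1; rewrite subrr inE.
split=> // [x y Vx Vy | d x Vx]; last first.
  by apply: overring_mul => //; apply: DV; exists d.
have VN : V (- y) by have := VB 0 y; rewrite !inE sub0r; apply.
by have := VB x (- y); rewrite !inE opprK; apply.
Qed.

Lemma valuation_ideal_contraction I V z v : mulI I V `&` carrierD = I ->
  I z -> V v -> carrierD (v * z) -> I (v * z).
Proof.
by move=> IE Iz Vv Dvz; rewrite -IE; split=> //; rewrite mulrC; apply: mulI_mem.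
Qed.

(** Write b = v a, let s generate I up to
    divisorial closure and let u multiply a and s into D.  For z in I the
    element u b z = v (u a) z is in D and in I V, hence in I; so u b
    multiplies I into itself and is in D.  Thus b is in the divisorial
    closure of a and s, hence in T. *)
Lemma t_ideal_valuation_closed I V T a v :
  is_ideal I -> v_finite I -> multiplier_trivial I ->
  mulI I V `&` carrierD = I -> t_ideal T -> I `<=` T ->
  T a -> V v -> carrierD (v * a) -> T (v * a).
Proof.
move=> [sI ID] [s sI' Is] mI IE /t_idealP[_ _ _ clT] IT Ta Vv Dva.
apply: (clT (a :: s)) => [y | u us].
  by rewrite inE => /orP[/eqP-> // | /sI'/IT].
have ua : carrierD (u * a) by apply: us; rewrite mem_head.
have uI z : I z -> carrierD (u * z).
  by move=> /Is; apply=> y sy; apply: us; rewrite inE sy orbT.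
apply: mI => z Iz.
have -> : u * (v * a) * z = v * (u * a * z) by rewrite !mulrA (mulrC u).
apply: (valuation_ideal_contraction IE) => //; first exact: submoduleM.
have -> : v * (u * a * z) = v * a * (u * z) by rewrite (mulrC u) !mulrA.
by apply: carrierDM => //; apply: uI.
Qed.

(** Take a in T but not in T', and b in T'.  If a / b were in V, then a would
    lie in T' because b does; so b / a is in V and b lies in T. *)
Lemma t_ideals_over_chain I T T' :
  valuation_ideal I -> v_finite I -> multiplier_trivial I ->
  t_ideal T -> t_ideal T' -> I `<=` T -> I `<=` T' -> T `<=` T' \/ T' `<=` T.
Proof.
move=> [iI [V [oV VV] IE]] fI mI tT tT' IT IT'.
have /t_idealP[[T0 _ _] _ TD _] := tT.
have /t_idealP[[T'0 _ _] _ T'D _] := tT'.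
case: (pselect (T `<=` T')) => [|/existsNP[a /not_implyP[Ta nT'a]]].
  by left.
right=> b T'b.
have a0 : a != 0 by apply: contra_notN nT'a => /eqP->.
have [-> // | b0] := eqVneq b 0.
case: (VV (b / a)) => [| Vba | Vab]; first by rewrite mulf_neq0 ?invr_neq0.
  rewrite -[b](divfK a0).
  apply: (t_ideal_valuation_closed iI fI mI IE tT IT Ta Vba).
  by rewrite divfK //; apply: T'D.
case: nT'a; rewrite -[a](divfK b0).
apply: (t_ideal_valuation_closed iI fI mI IE tT' IT' T'b).
  by rewrite -invf_div.
by rewrite divfK //; apply: TD.
Qed.

Lemma maximal_t_ideal_over_unique I M M' :
  valuation_ideal I -> v_finite I -> multiplier_trivial I ->
  maximal_t_ideal M -> maximal_t_ideal M' -> I `<=` M -> I `<=` M' -> M = M'.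
Proof.
move=> vI fI mI [tM MnD maxM] [tM' M'nD maxM'] IM IM'.
have [MM' | M'M] := t_ideals_over_chain vI fI mI tM tM' IM IM'.
  by rewrite (maxM M').
by rewrite (maxM' M).
Qed.

(** The proper t-ideals that contain I form a chain, so their union is again
    one. *)
Lemma maximal_t_ideal_exists I T :
  valuation_ideal I -> v_finite I -> multiplier_trivial I ->
  t_ideal T -> T <> carrierD -> I `<=` T ->
  exists M, maximal_t_ideal M /\ T `<=` M.
Proof.
move=> vI fI mI tT TnD IT.
pose F := [set J | [/\ t_ideal J, J <> carrierD & I `<=` J]].
have FT : F T by [].
have chainF J J' : F J -> F J' -> J `<=` J' \/ J' `<=` J.
  by move=> [tJ _ IJ] [tJ' _ IJ']; apply: t_ideals_over_chain IJ IJ'.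
pose M := \bigcup_(J in F) J.
have FM J : F J -> J `<=` M by move=> FJ x Jx; exists J.
have listM s : (forall y, y \in s -> M y) ->
    exists2 J, F J & forall y, y \in s -> J y.
  elim: s => [_|x s IHs sM]; first by exists T.
  have [|J FJ Js] := IHs; first by move=> y sy; apply: sM; rewrite inE sy orbT.
  have [J' FJ' J'x] := sM x (mem_head x s).
  have [JJ' | J'J] := chainF _ _ FJ FJ'; [exists J' | exists J] => // y;
    rewrite inE => /orP[/eqP-> // | sy].
  - exact/JJ'/Js.
  - exact: J'J.
  - exact: Js.
have MD : M `<=` carrierD by move=> x [J [/t_idealP[_ _ JD _] _ _] /JD].
have clM s : (forall y, y \in s -> M y) -> vclosure s `<=` M.
  move=> /listM[J FJ Js] x sx; apply: (FM _ FJ).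
  by have [/t_idealP[_ _ _ clJ] _ _] := FJ; apply: clJ sx.
have tM : t_ideal M.
  have /t_idealP[[T0 _ _] [z Tz z0] _ _] := tT.
  apply/t_idealP; split=> //; last by exists z => //; apply: FM Tz.
  split; first exact: (FM _ FT).
  - move=> x y Mx My; have xyM w : w \in [:: x; y] -> M w.
      by rewrite !inE => /orP[] /eqP->.
    apply: clM xyM _ _; have [_ vD _] := vclosure_submodule [:: x; y].
    by apply: vD; apply: mem_vclosure; rewrite !inE eqxx ?orbT.
  - move=> d x [J FJ Jx]; exists J => //.
    by have [/t_idealP[[_ _ JZ] _ _ _] _ _] := FJ; apply: JZ.
have MnD : M <> carrierD.
  move=> ME; have [J [/t_idealP[sJ _ JD _] JnD _] J1] : M 1.
    by rewrite ME; exact: carrierD1.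
  apply: JnD; apply/seteqP; split=> // x Dx.
  by rewrite -[x]mulr1; apply: submoduleM.
exists M; split; last exact: FM.
split=> // J tJ JnD MJ; apply/seteqP; split=> //; apply: (FM J); split=> //.
by move=> x /IT Tx; apply: MJ; apply: FM Tx.
Qed.

(** * Integral elements *)

(** If x is not in V then 1/x is, and an integral equation for x divided by
    a power of x expresses x as a polynomial in 1/x over D. *)
Lemma valuation_overring_integral V x :
  valuation_overring V -> integralOver (@tofrac D) x -> V x.
Proof.
move=> [oV VV] [p mon_p]; have [_ DV] := oV.
have sV := overring_submodule oV.
have [-> _ | x0] := eqVneq x 0; first by case: sV.
have [//|Vx'] := VV x x0.
have VX m : V (x^-1 ^+ m).
  elim: m => [|m IHm]; first by rewrite expr0; apply/DV/carrierD1.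
  by rewrite exprS; apply: overring_mul.
have size_map : size (map_poly (@tofrac D) p) = size p.
  apply: size_map_inj_poly => [b c /eqP|]; last exact: tofrac0.
  by rewrite tofrac_eq => /eqP.
case sz_p: (size p) => [|[|m]].
- by move/eqP: sz_p; rewrite size_poly_eq0 (negPf (monic_neq0 mon_p)).
- have /eqP := size1_polyC (eq_leq sz_p); move: mon_p.
  rewrite monicE lead_coefE.
  rewrite sz_p /= => /eqP-> /eqP->.
  by rewrite map_polyC /= tofrac1 rootC oner_eq0.
have lead_p : p`_m.+1 = 1 by have /eqP := mon_p; rewrite lead_coefE sz_p.
rewrite rootE horner_coef size_map sz_p big_ord_recr /= coef_map /= lead_p.
rewrite tofrac1 mul1r addrC addr_eq0 => /eqP xE.
have -> : x = x ^+ m.+1 * x^-1 ^+ m.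
  by rewrite exprS -mulrA -exprMn divff // expr1n mulr1.
rewrite xE -mulN1r -mulrA mulr_suml.
apply: submoduleM => //.
  by exists (-1) => //; rewrite tofracN tofrac1.
apply: submodule_sum => // i; rewrite coef_map -mulrA.
apply: submoduleM => //; first by exists p`_i.
have -> : x ^+ i * x^-1 ^+ m = x^-1 ^+ (m - i); last exact: VX.
have le_im : (i <= m)%N by rewrite -ltnS.
rewrite -[in x^-1 ^+ m](subnK le_im) exprD mulrCA -exprMn.
by rewrite divff // expr1n mulr1.
Qed.

(** The factors are stripped one at a time: for z in the product of the others
    and y in the first factor J, x z y is in D and, as x is in V, in J V;
    so x z multiplies J into itself and is in D. *)
Lemma prodI_multiplier n (I : 'I_n -> set K) x :
  (forall i, valuation_ideal (I i)) -> (forall i, multiplier_trivial (I i)) ->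
  (forall V, valuation_overring V -> V x) ->
  (forall w, prodI I w -> carrierD (x * w)) -> carrierD x.
Proof.
move=> + + Vx; elim: n I => [|n IHn] I vI mI xI.
  by rewrite -[x]mulr1; apply: xI; rewrite prodI0; exact: carrierD1.
apply: (IHn (fun i => I (lift ord0 i))) => // z Bz.
have Dz : carrierD z.
  by apply: prodI_integral Bz => i; case: (vI (lift ord0 i)) => -[].
apply: (mI ord0) => y Iy; have [_ [V [oV VV] IE]] := vI ord0.
apply: (valuation_ideal_contraction IE) => //.
  by apply: overring_mul => //; [exact: Vx | case: oV => _; apply].
by rewrite -mulrA (mulrC z); apply: xI; rewrite prodIS; apply: mulI_mem.
Qed.

(** * Factors of a principal ideal *)

Section VIFD.
Variable star : set K -> set K.
Hypotheses (star_op : star_operation star) (star_ft : star_finite_type star).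
Hypothesis star_vifd : star_VIFD D star.

Lemma star_VIFD_factors (a : D) : a != 0 ->
  exists n (I : 'I_n -> set K),
  [/\ forall i, [/\ valuation_ideal (I i), v_finite (I i)
                  & multiplier_trivial (I i)]
    & forall T, submodule T -> T (tofrac a) -> prodI I `<=` T].
Proof.
move=> a0; have [n [I [_ vI fI aE]]] := star_vifd a0.
exists n, I; split=> [i | T]; last exact: (prodI_sub_star star_op fI aE).
split=> //; first exact: (factor_v_finite star_op star_ft a0 fI aE).
exact: (factor_multiplier_trivial star_op a0 fI aE).
Qed.

Lemma prime_t_ideal_factor n (I : 'I_n -> set K) (a : D) P :
  (forall i, valuation_ideal (I i)) ->
  (forall T, submodule T -> T (tofrac a) -> prodI I `<=` T) ->
  t_ideal P -> P <> carrierD ->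
  (forall x y, carrierD x -> carrierD y -> P (x * y) -> P x \/ P y) ->
  P (tofrac a) -> exists i, I i `<=` P.
Proof.
move=> vI subI /t_idealP[sP _ PD _] PnD primeP Pa.
apply: (prime_contains_factor _ PD PnD sP primeP).
  by move=> i; case: (vI i) => -[].
exact: subI.
Qed.

End VIFD.

End TIdeals.

Theorem corollary3p13 (D : idomainType)
    (star : set {fraction D} -> set {fraction D})
    (star_op : star_operation star) (star_ft : star_finite_type star)
    (star_vifd : star_VIFD D star) :
  integrally_closed D /\ weakly_Matlis D.
Proof.
have factors := star_VIFD_factors star_op star_ft star_vifd.
split; [|split].
- move=> x int_x; have [a a0 Dax] := frac_denominator x.
  have [n [I [IP subI]]] := factors a a0.
  apply: (@prodI_multiplier _ n I) => [i|i|V vV|w Iw]; try by case: (IP i).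
    exact: valuation_overring_integral.
  have [D0 DD _] := carrierD_submodule D.
  apply: (subI [set w | carrierD (x * w)]) => //=; last by rewrite mulrC.
  split=> [|y z|d y] /=; first by rewrite mulr0.
    by rewrite mulrDr; apply: DD.
  by rewrite mulrCA; apply: carrierDM; exists d.
- move=> a a0 _; have [n [I [IP subI]]] := factors a a0.
  have vI i : valuation_ideal (I i) by case: (IP i).
  apply: (@sub_finite_set _ _
    (\bigcup_(i in [set: 'I_n]) [set M | maximal_t_ideal M /\ I i `<=` M])).
    move=> M [maxM Ma]; have [tM MnD _] := maxM.
    have [|i IiM] := prime_t_ideal_factor vI subI tM MnD _ Ma.
      by move=> x y; apply: maximal_t_ideal_prime.
    by exists i.
  apply: bigcup_finite => [|i _]; first exact: finite_finset.
  case: (pselect (exists M, maximal_t_ideal M /\ I i `<=` M)); last first.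
    move=> noM; apply: (@sub_finite_set _ _ set0) => // M MP; apply: noM.
    by exists M.
  move=> [M [maxM IM]]; apply: (@sub_finite_set _ _ [set M]) => //.
  move=> M' [maxM' IM']; have [vIi fIi mIi] := IP i.
  exact: (maximal_t_ideal_over_unique vIi fIi mIi).
- move=> P [_ PnD primeP] tP; have /t_idealP[_ [x Px x0] PD _] := tP.
  have [a _ aE] := PD x Px; have a0 : a != 0.
    by apply: contra_neq x0 => a0; rewrite -aE a0 tofrac0.
  have [n [I [IP subI]]] := factors a a0.
  have [||i IiP] := prime_t_ideal_factor (fun i => let: And3 v _ _ := IP i in v)
    subI tP PnD.
  + by move=> _ _ [b _ <-] [c _ <-]; rewrite -tofracM; apply: primeP.
  + by rewrite aE.
  have [vI fI mI] := IP i.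
  have [M [maxM PM]] := maximal_t_ideal_exists vI fI mI tP PnD IiP.
  exists M; split=> // M' [maxM' PM'].
  by apply: (maximal_t_ideal_over_unique vI fI mI) => // y /IiP; auto.
Qed.
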